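(* Let $\alpha\in(0,1)$, and let $\mathcal M$ be a convex class of probability distributions on $\mathbb R$ such that there are $F,G,H\in\mathcal M$ with $q_\alpha(F)\cap q_\alpha(G)=\{t_1\}$ and $q_\alpha(F)\cap q_\alpha(H)=\{t_2\}$ for some $t_1\ne t_2$. Then no specification of the $\alpha$-quantile is elicitable (on $\mathcal M$).
   Context: The (set-valued) $\alpha$-quantile of $F$ is $q_\alpha(F)=\{t\in\mathbb R:F((-\infty,t))\le\alpha\le F((-\infty,t])\}$. A specification of it on $\mathcal M$ is a map $T\colon\mathcal M\to\mathbb R$ with $T(F)\in q_\alpha(F)$ for all $F\in\mathcal M$. A scoring function is a map $S\colon\mathbb R\times\mathbb R\to(-\infty,\infty]$ such that $\bar S(x,F)=\int S(x,y)\,dF(y)$ exists; it is assumed $\mathcal M$-finite, i.e. $\bar S(x,F)<\infty$ for all $x\in\mathbb R$, $F\in\mathcal M$. $T$ is elicitable on $\mathcal M$ if there is an $\mathcal M$-finite scoring function $S$ with $\bar S(T(F),F)\le\bar S(x,F)$ for all $x\in\mathbb R$, $F\in\mathcal M$, with equality only if $x=T(F)$. *)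

(* Defs.v *)
From HB Require Import structures.
From mathcomp Require Import all_boot all_order all_algebra.
From mathcomp Require Import all_classical all_reals all_analysis.
From mathcomp Require Import measurable_realfun.
Set Implicit Arguments.
Unset Strict Implicit.
Unset Printing Implicit Defensive.
Import Order.TTheory GRing.Theory Num.Theory.
Import numFieldNormedType.Exports.
Local Open Scope classical_set_scope.
Local Open Scope ring_scope.

Definition distr (R : realType) := probability R R.

Section mixture.
Context {R : realType} (p : {i01 R}) (F G : distr R).

Definition mixture : set R -> \bar R :=
  measure_add (mscale (p%:num%:nng) F)
              (mscale ((1 - p%:num)%:i01%:num%:nng) G).

HB.instance Definition _ := Measure.on mixture.

Let mixture_setT : mixture [set: _] = 1%E.
Proof.
by rewrite /mixture measure_addE/= /mscale/= !probability_setT !mule1 -EFinD subrKC.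
Qed.

HB.instance Definition _ :=
  @Measure_isProbability.Build _ _ R mixture mixture_setT.

Lemma mixtureE (A : set R) :
  mixture A = (p%:num%:E * F A + (1 - p%:num)%:E * G A)%E.
Proof. by rewrite /mixture measure_addE. Qed.

End mixture.

Definition convex_class (R : realType) (M : set (distr R)) : Prop :=
  forall (p : {i01 R}) (F G : distr R),
    M F -> M G -> M (mixture p F G : distr R).

Section elicitability.
Context {R : realType}.
Local Open Scope ereal_scope.

Definition quantile (alpha : R) (F : distr R) : set R :=
  [set t : R | F `]-oo, t[%classic <= alpha%:E /\
               alpha%:E <= F `]-oo, t]%classic].

Definition quantile_specification (alpha : R) (M : set (distr R))
    (T : distr R -> R) : Prop :=
  forall F, M F -> quantile alpha F (T F).

(** The integral exists in [-oo, +oo]. This must be required separately since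
    [integral] is a total function (it takes the value -oo when both parts
    have infinite integral). *)
Definition integral_exists (F : distr R) (f : R -> \bar R) : Prop :=
  measurable_fun [set: R] f /\
  (\int[F]_y f^\+ y < +oo \/ \int[F]_y f^\- y < +oo).

Definition scoring_function (M : set (distr R))
    (S : R -> R -> \bar R) : Prop :=
  (forall x y, -oo < S x y) /\
  (forall x F, M F -> integral_exists F (S x)).

Definition expected_score (S : R -> R -> \bar R)
    (x : R) (F : distr R) : \bar R :=
  \int[F]_y S x y.

Definition finite_score (M : set (distr R))
    (S : R -> R -> \bar R) : Prop :=
  forall x F, M F -> expected_score S x F < +oo.

(** Only the values of [T] on [M] matter here and in
    [quantile_specification], so that [T] stands for a map from [M] to the
    reals. *)
Definition elicitable (M : set (distr R)) (T : distr R -> R) : Prop :=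
  exists S : R -> R -> \bar R,
    [/\ scoring_function M S, finite_score M S &
      forall x F, M F ->
        expected_score S (T F) F <= expected_score S x F /\
        (expected_score S (T F) F = expected_score S x F -> x = T F)].

End elicitability.

(* Main.v *)
(** When the quantile sets of [F] and [G] meet, their intersection is the
    quantile set of every proper mixture of [F] and [G]. So [T] is [t1] on the
    mixtures of [F] and [G] and [t2] on those of [F] and [H]; letting the
    mixtures tend to [F], both [t1] and [t2] minimize the expected score under
    [F], against strictness. The limit argument needs finite scores, and
    expected scores equal to [-oo] are excluded separately. *)

Require Import Defs.
From HB Require Import structures.
From mathcomp Require Import all_boot all_order all_algebra.
From mathcomp Require Import all_classical all_reals all_analysis.
From mathcomp Require Import lra ring measurable_realfun.
Import Order.TTheory GRing.Theory Num.Theory.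
Local Open Scope classical_set_scope.
Local Open Scope ring_scope.

Lemma affine_le0_limit (R : realType) (u v : R) :
  (forall p : R, 0 < p < 1 -> p * u + (1 - p) * v <= 0) -> v <= 0.
Proof.
move=> H; rewrite leNgt; apply/negP => v0.
have u0 : 0 <= `|u| by [].
have d0 : 0 < 2 * (`|u| + v) by lra.
(* So small that [p * (v - u) <= v / 2], which keeps the combination at least [v / 2 > 0]. *)
set p := v / (2 * (`|u| + v)).
have p0 : 0 < p by rewrite divr_gt0.
have p1 : p <= 1 / 2 by rewrite ler_pdivrMr //; lra.
have /H : 0 < p < 1 by lra.
have -> : p * u + (1 - p) * v = v - p * (v - u) by ring.
suff : p * (v - u) <= v / 2 by lra.
have -> : v / 2 = p * (`|u| + v) by rewrite /p; field; lra.
rewrite ler_pM2l //; have := ler_norm (- u); rewrite normrN; lra.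
Qed.

Lemma distr_finE (R : realType) (F : distr R) (A : set R) :
  measurable A -> F A = (fine (F A))%:E.
Proof. by move=> mA; rewrite fineK// fin_num_measure. Qed.

Lemma mixture_fine (R : realType) (p : {i01 R}) (F G : distr R) (A : set R) :
  measurable A -> (mixture p F G : distr R) A =
    (p%:num * fine (F A) + (1 - p%:num) * fine (G A))%:E.
Proof.
move=> mA; apply: etrans (mixtureE p F G A) _.
by rewrite [RHS]EFinD !EFinM -!distr_finE.
Qed.

Lemma quantile_fineE (R : realType) (alpha : R) (F : distr R) (t : R) :
  quantile alpha F t <->
  fine (F `]-oo, t[%classic) <= alpha <= fine (F `]-oo, t]%classic).
Proof.
rewrite -!lee_fin -!distr_finE//.
by split=> [[? ?]|/andP[? ?]]; first exact/andP.
Qed.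

Lemma quantile_mixtureE (R : realType) (alpha : R) (p : {i01 R})
    (F G : distr R) (t : R) :
  quantile alpha (mixture p F G) t <->
  p%:num * fine (F `]-oo, t[%classic) +
    (1 - p%:num) * fine (G `]-oo, t[%classic) <= alpha <=
  p%:num * fine (F `]-oo, t]%classic) +
    (1 - p%:num) * fine (G `]-oo, t]%classic).
Proof. by rewrite quantile_fineE !mixture_fine. Qed.

Lemma fine_distr_le (R : realType) (F : distr R) (A B : set R) :
  measurable A -> measurable B -> A `<=` B -> fine (F A) <= fine (F B).
Proof.
move=> mA mB AB; rewrite -lee_fin -!distr_finE //.
by apply: le_measure => //; rewrite inE.
Qed.

(** Suppose [t] lies below the common quantile [s]. For [F] and [G] the mass of []-oo, t]] is at
    most that of []-oo, s[], hence at most [alpha]; the average with positive weights is at least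
    [alpha], so both masses equal [alpha]. The case [s < t] is dual. *)
Lemma quantile_mixture_sub (R : realType) (alpha : R) (p : {i01 R})
    (F G : distr R) :
  0 < p%:num < 1 -> quantile alpha F `&` quantile alpha G !=set0 ->
  quantile alpha (mixture p F G) `<=` quantile alpha F `&` quantile alpha G.
Proof.
move=> /andP[p0 p1] [s [/quantile_fineE Fs /quantile_fineE Gs]] t.
move=> /quantile_mixtureE mt.
have oc (K : distr R) :
    fine (K `]-oo, t[%classic) <= fine (K `]-oo, t]%classic).
  by apply: fine_distr_le => // x /=; rewrite !in_itv /=; exact: ltW.
have [ocF ocG] := (oc F, oc G).
have le (K : distr R) (x y : R) :
    x < y -> fine (K `]-oo, x]%classic) <= fine (K `]-oo, y[%classic).
  move=> xy; apply: fine_distr_le => // z /=.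
  by rewrite !in_itv /= => /le_lt_trans; exact.
have [ts|st|->] := ltgtP t s; last by split; apply/quantile_fineE.
- have [leF leG] := (le F _ _ ts, le G _ _ ts).
  by split; apply/quantile_fineE/andP; split; nra.
- have [leF leG] := (le F _ _ st, le G _ _ st).
  by split; apply/quantile_fineE/andP; split; nra.
Qed.

(** Both quantile inequalities are affine in [p], so they survive [p -> 0], where only [G] is
    left. *)
Lemma quantile_mixture_limit (R : realType) (alpha : R) (F G : distr R)
    (t : R) :
  (forall p : {i01 R}, 0 < p%:num < 1 -> quantile alpha (mixture p F G) t) ->
  quantile alpha G t.
Proof.
move=> H; apply/quantile_fineE.
have {}H (p : R) : 0 < p < 1 ->
    p * fine (F `]-oo, t[%classic) + (1 - p) * fine (G `]-oo, t[%classic)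
    <= alpha <=
    p * fine (F `]-oo, t]%classic) + (1 - p) * fine (G `]-oo, t]%classic).
  move=> p01; have /andP[/ltW p0 /ltW p1] := p01.
  by have /quantile_mixtureE := H (Itv01 p0 p1) p01.
apply/andP; split; rewrite -subr_le0.
- apply: (@affine_le0_limit _ (fine (F `]-oo, t[%classic) - alpha)) => p /H.
  by lra.
- apply: (@affine_le0_limit _ (alpha - fine (F `]-oo, t]%classic))) => p /H.
  by lra.
Qed.

Section expected_scores.
Context {R : realType}.
Local Open Scope ereal_scope.

Lemma ge0_integral_mixture (p : {i01 R}) (F G : distr R) (f : R -> \bar R) :
  measurable_fun [set: R] f -> (forall y, 0 <= f y) ->
  \int[mixture p F G]_y f y =
  p%:num%:E * \int[F]_y f y + (1 - p%:num)%:E * \int[G]_y f y.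
Proof.
move=> mf f0; rewrite ge0_integral_measure_add//.
by rewrite !ge0_integral_mscale.
Qed.

(** Existence is essential: since +oo - (+oo) = -oo by convention, an integral below +oo could
    otherwise hide an infinite positive part. *)
Lemma integral_funepos_lty (F : distr R) (f : R -> \bar R) :
  integral_exists F f -> \int[F]_y f y < +oo -> \int[F]_y f^\+ y < +oo.
Proof.
move=> [mf [//|negfin]]; rewrite integralE.
have : 0 <= \int[F]_y f^\- y by apply: integral_ge0.
have : 0 <= \int[F]_y f^\+ y by apply: integral_ge0.
by case: (\int[F]_y f^\+ y) (\int[F]_y f^\- y) negfin => [a| |] [b| |]//=;
  rewrite ?ltry.
Qed.

(** Meant for [a], [c] integrals of positive parts and [b], [d] integrals of negative parts, which
    may be +oo. *)
Lemma ge0_affine_subeACA (k l : R) (a b c d : \bar R) :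
  (0 <= k)%R -> (0 <= l)%R -> a \is a fin_num -> c \is a fin_num ->
  0 <= b -> 0 <= d ->
  k%:E * a + l%:E * c - (k%:E * b + l%:E * d) =
  k%:E * (a - b) + l%:E * (c - d).
Proof.
move=> k0 l0 afin cfin b0 d0; rewrite !muleBr ?fin_num_adde_defr//.
rewrite oppeD; first by rewrite addeACA.
by apply: ge0_adde_def; rewrite inE mule_ge0// lee_fin.
Qed.

Lemma integral_mixture (p : {i01 R}) (F G : distr R) (f : R -> \bar R) :
  integral_exists F f -> integral_exists G f ->
  \int[F]_y f y < +oo -> \int[G]_y f y < +oo ->
  \int[mixture p F G]_y f y =
  p%:num%:E * \int[F]_y f y + (1 - p%:num)%:E * \int[G]_y f y.
Proof.
move=> iF iG fF fG.
have mf := iF.1.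
have := integral_funepos_lty _ _ iF fF; have := integral_funepos_lty _ _ iG fG.
rewrite !(integralE _ _ f) !ge0_integral_mixture//; first last.
- exact: measurable_funepos.
- exact: measurable_funeneg.
move=> Gy Fy; apply: ge0_affine_subeACA; rewrite ?ge0_fin_numE// ?subr_ge0//;
  exact: integral_ge0.
Qed.

Lemma mixtures_not_prefer (a b c d : \bar R) :
  b != -oo -> c < a -> a < +oo -> b < +oo -> d < +oo ->
  ~ (forall p : R, (0 < p < 1)%R ->
       p%:E * a + (1 - p)%:E * b < p%:E * c + (1 - p)%:E * d).
Proof.
move=> bNy ca ay by_ dy H.
have h01 : (0 < (1 / 2 : R) < 1)%R by lra.
have h2 : (0 < 1 - (1 / 2 : R))%R by lra.
have h1 : (0 < (1 / 2 : R))%R by lra.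
(* The equal-weight instance shows that [c] and [d] are not -oo: otherwise its right side would be
   -oo, with nothing strictly below. So all four values are finite. *)
have := H _ h01.
case: c ca H => [c| |] ca H; last 2 first.
- by move: (lt_trans ca ay); rewrite ltxx.
- by rewrite gt0_muleNy ?lte_fin// addNye ltNge leNye.
case: d dy H => [d| |] // _ H; last first.
  by rewrite gt0_muleNy ?lte_fin// addeNy ltNge leNye.
case: a ca ay H => [a| |] // ca _ H _.
case: b bNy by_ H => [b| |] // _ _ H.
move: ca; rewrite lte_fin ltNge => /negP; apply.
(* The weight of [a] and [c] tends to 1, so it is [1 - p] that goes into [H]. *)
rewrite -subr_le0; apply: (@affine_le0_limit _ (b - d)%R) => p p01.
have /H : (0 < 1 - p < 1)%R by lra.
by rewrite -!EFinM -!EFinD lte_fin; lra.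
Qed.

(* If [T F] differed from [t1], comparing the scores of [t1] and [T F] on the
   mixtures of [F] and [G] near [F] would be contradictory unless the score of
   [t1] under [G] is [-oo]. In that case [t1] is optimal for every proper
   mixture of [G] and [H], hence in the limit a quantile of [H]. *)
Lemma elicitable_forces_value (alpha : R) (M : set (distr R))
    (T : distr R -> R) (S : R -> R -> \bar R) (F G H : distr R) (t1 t2 : R) :
  convex_class M -> quantile_specification alpha M T ->
  scoring_function M S -> finite_score M S ->
  (forall x F, M F ->
    expected_score S (T F) F <= expected_score S x F /\
    (expected_score S (T F) F = expected_score S x F -> x = T F)) ->
  M F -> M G -> M H ->
  quantile alpha F `&` quantile alpha G = [set t1] ->
  quantile alpha F `&` quantile alpha H = [set t2] ->
  t1 <> t2 -> T F = t1.
Proof.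
move=> cM qT [_ iS] fS opt MF MG MH FG FH t12.
apply: contrapT => TFt1.
have strict x K : M K -> x <> T K ->
    expected_score S (T K) K < expected_score S x K.
  move=> MK xT; have [le eq] := opt x K MK.
  by rewrite lt_neqAle le andbT; apply/eqP => /eq.
have mixE (p : {i01 R}) (K L : distr R) x : M K -> M L ->
    expected_score S x (mixture p K L) =
    p%:num%:E * expected_score S x K + (1 - p%:num)%:E * expected_score S x L.
  by move=> MK ML; apply: integral_mixture; (exact: iS || exact: fS).
have Tmix (p : {i01 R}) : (0 < p%:num < 1)%R -> T (mixture p F G) = t1.
  move=> p01.
  have : quantile alpha (mixture p F G) (T (mixture p F G)) by apply/qT/cM.
  move/quantile_mixture_sub; rewrite FG; apply => //.
  by exists t1.
have Gt1 : expected_score S t1 G != -oo.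
  apply/eqP => Gt1.
  (* As [t1] is already a quantile of [F], this would put it into [[set t2]]. *)
  suff Ht1 : quantile alpha H t1.
    have Ft1 : (quantile alpha F `&` quantile alpha G) t1 by rewrite FG.
    have : (quantile alpha F `&` quantile alpha H) t1 by split => //; case: Ft1.
    by rewrite FH.
  apply: (@quantile_mixture_limit _ _ G) => p /andP[p0 p1].
  have MGH := cM p _ _ MG MH.
  suff -> : t1 = T (mixture p G H) by exact: qT.
  apply: contrapT => /(strict _ _ MGH).
  (* [G] has positive weight, so [t1] scores -oo on the mixture and cannot be strictly beaten. *)
  rewrite (mixE _ _ _ t1)// Gt1 gt0_muleNy ?lte_fin// addNye.
  by rewrite ltNge leNye.
apply: (@mixtures_not_prefer (expected_score S t1 F) (expected_score S t1 G)
  (expected_score S (T F) F) (expected_score S (T F) G)) => //.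
- by apply: strict => // /esym.
- exact: fS.
- exact: fS.
- exact: fS.
move=> p p01; have /andP[/ltW p0 /ltW p1] := p01.
have := Tmix (Itv01 p0 p1) p01.
set m := mixture _ F G => Tm.
have := strict (T F) m (cM _ _ _ MF MG).
by rewrite Tm !mixE//; exact.
Qed.

End expected_scores.

Theorem proposition3p13 (R : realType) (alpha : R) (M : set (distr R)) :
  0 < alpha < 1 ->
  convex_class M ->
  (exists (F G H : distr R) (t1 t2 : R),
    [/\ M F, M G & M H] /\
    [/\ quantile alpha F `&` quantile alpha G = [set t1],
        quantile alpha F `&` quantile alpha H = [set t2] &
        t1 <> t2]) ->
  forall T : distr R -> R,
    quantile_specification alpha M T -> ~ elicitable M T.
Proof.
move=> _ cM [F [G [H [t1 [t2 [[MF MG MH] [FG FH t12]]]]]]] T qT [S [sS fS opt]].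
apply: (t12).
have <- : T F = t1.
  exact: elicitable_forces_value cM qT sS fS opt MF MG MH FG FH t12.
(* Exchanging the roles of [G], [t1] and [H], [t2] gives the second value of [T F]. *)
by apply: elicitable_forces_value cM qT sS fS opt MF MH MG FH FG _ => /esym.
Qed.
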